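(* Let $\{f(\cdot\mid\theta):\theta\in\Theta\}$ be a kernel family such that the mapping $\theta\mapsto f(x\mid\theta)$ is continuous on $\Theta$ for $\lambda$-almost every $x$. If there exist two Borel probability measures $G_1,G_2\in\mathcal P(\Theta)$ with $G_1\neq G_2$ and $p_{G_1}=p_{G_2}$ $\lambda$-almost everywhere, then $$\inf_{n\in\mathbb N}\ \inf_{\hat G_n}\ \sup_{G_*\in\mathcal D(\Theta)}\mathbb E_{X_{1:n}\sim P_{G_*}^n}\big[W_1(\hat G_n(X_{1:n}),G_* )\big]\ \ge\ \frac{3c}{32},$$ where $c=W_1(G_1,G_2)$ and the inner infimum is taken over all estimators $\hat G_n:\mathcal X^n\to\mathcal D(\Theta)$.
   Context: Standing setting. The sample space $\mathcal X$ is a Borel subset of $\mathbb R^{d_1}$ with a $\sigma$-finite Borel measure $\lambda$ (understood to be Lebesgue measure for continuous kernels and counting measure for discrete ones). The parameter space $\Theta\subset\mathbb R^{d_2}$ is compact and equal to the closure of its interior $\Theta^\circ$, which is non-empty. A kernel is a jointly measurable function $f:\mathcal X\times\Theta\to[0,\infty)$, written $f(x\mid\theta)$, with $\int_{\mathcal X}f(x\mid\theta)\,\lambda(dx)=1$ for every $\theta\in\Theta$. $\mathcal P(\Theta)$ is the set of Borel probability measures on $\Theta$ and $\mathcal D(\Theta)\subset\mathcal P(\Theta)$ the set of discrete ones (those with at most countable support). For $G\in\mathcal P(\Theta)$, $p_G(x):=\int_\Theta f(x\mid\theta)\,G(d\theta)$, which is a probability density with respect to $\lambda$; $P_G$ is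 the probability measure on $\mathcal X$ with density $p_G$, and $P_G^n$ its $n$-fold product on $\mathcal X^n$; $X_{1:n}=(X_1,\ldots,X_n)$. Estimators are measurable maps. $W_1(G_1,G_2)=\inf_{\pi}\int\|\theta_1-\theta_2\|\,\pi(d\theta_1,d\theta_2)$, the infimum being over probability measures $\pi$ on $\Theta^2$ with marginals $G_1$ and $G_2$, is the Wasserstein distance of order 1 for the Euclidean norm. *)

(* Defs.v *)
From HB Require Import structures.
From mathcomp Require Import all_boot all_order all_algebra.
From mathcomp Require Import all_classical all_reals all_analysis.
From mathcomp Require Import measurable_realfun.
Set Implicit Arguments.
Unset Strict Implicit.
Unset Printing Implicit Defensive.
Import Order.TTheory GRing.Theory Num.Theory.
Import numFieldNormedType.Exports.
Local Open Scope classical_set_scope.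
Local Open Scope ring_scope.

(* R^d carries its Borel sigma-algebra, generated by the open sets. *)
HB.instance Definition _ (R : realType) (d : nat) :=
  Measurable.copy 'rV[R]_d (g_sigma_algebraType (@open 'rV[R]_d)).

Lemma compact_measurable_rV (R : realType) (d : nat) (A : set 'rV[R]_d) :
  compact A -> measurable A.
Proof.
move=> cA; rewrite -[A]setCK; apply: measurableC.
apply: sub_sigma_algebra; apply: closed_openC.
exact: compact_closed.
Qed.

Section product_power.
Context (R : realType) d (T : measurableType d).

Definition tuple_cons n (z : T * n.-tuple T) : n.+1.-tuple T :=
  [tuple of z.1 :: z.2].

Let measurable_tuple_cons n : measurable_fun setT (@tuple_cons n).
Proof. exact: measurable_cons. Qed.

HB.instance Definition _ n :=
  isMeasurableFun.Build _ _ _ _ (@tuple_cons n) (@measurable_tuple_cons n).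

Fixpoint prob_power (P : probability T R) (n : nat) :
    probability (n.-tuple T) R :=
  match n with
  | 0 => dirac [tuple]
  | m.+1 => distribution (P \x prob_power P m)%E (@tuple_cons m)
  end.

Lemma prob_power_box (P : probability T R) n (A : 'I_n -> set T) :
  (forall i, measurable (A i)) ->
  prob_power P n [set x | forall i, A i (tnth x i)] =
  (\prod_(i < n) P (A i))%E.
Proof.
elim: n A => [|n IHn] A mA /=.
  rewrite big_ord0 diracE; suff -> : [tuple] \in
    [set x : 0.-tuple T | forall i, A i (tnth x i)] by [].
  by rewrite inE => -[].
rewrite /distribution /pushforward.
have -> : @tuple_cons n @^-1` [set x | forall i, A i (tnth x i)] =
    A ord0 `*` [set x | forall i, A (lift ord0 i) (tnth x i)].
  apply/seteqP; split=> [[t x] /= Atx|[t x] [/= At Ax] i].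
    by split=> [|i]; [exact: Atx ord0|have := Atx (lift ord0 i); rewrite tnthS].
  by case: (unliftP ord0 i) => [j|] ->; rewrite ?tnthS// tnth0.
have mB : measurable [set x : n.-tuple T | forall i, A (lift ord0 i) (tnth x i)].
  rewrite (_ : mkset _ = \bigcap_(i in [set: 'I_n])
    ((fun x : n.-tuple T => tnth x i) @^-1` A (lift ord0 i))).
    apply: fin_bigcap_measurable => // i _; rewrite -[X in measurable X]setTI.
    exact: measurable_tnth.
  by apply/seteqP; split=> x /= Ax i; [move=> _|]; exact: Ax.
rewrite product_measure1E// big_ord_recl; congr (_ * _)%E.
exact: (IHn (fun i => A (lift ord0 i))).
Qed.

End product_power.

(* The base measure lives on the ambient R^d; only its restriction to the
   sample space is ever used.  A sigma-finite Borel measure on a Borel subset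
   X of R^d is the restriction to X of its extension by zero. *)
Record sample_space (R : realType) (d : nat) := SampleSpace {
  sample_set :> set 'rV[R]_d;
  measurable_sample_set : measurable sample_set;
  base_measure : {sigma_finite_measure set 'rV[R]_d -> \bar R} }.

Record parameter_space (R : realType) (d : nat) := ParameterSpace {
  parameter_set :> set 'rV[R]_d;
  parameter_set_compact : compact parameter_set;
  parameter_set_regular : parameter_set = closure parameter_set°;
  parameter_set_interior : parameter_set° !=set0 }.

(* The values of a kernel outside X x Theta are irrelevant. *)
Record density_kernel (R : realType) (d1 d2 : nat)
    (X : sample_space R d1) (Theta : parameter_space R d2) := DensityKernel {
  kernel_fun :> 'rV[R]_d1 -> 'rV[R]_d2 -> R;
  kernel_measurable :
    measurable_fun (X `*` Theta) (fun z => kernel_fun z.1 z.2);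
  kernel_ge0 : forall x theta,
    sample_set X x -> parameter_set Theta theta -> 0 <= kernel_fun x theta;
  kernel_int1 : forall theta, parameter_set Theta theta ->
    (\int[base_measure X]_(x in X) (kernel_fun x theta)%:E)%E = 1%E }.

(* Borel probability measures on Theta, seen as the Borel probability measures
   on R^d that give mass 1 to Theta. *)
Record prob_on (R : realType) (d : nat) (Theta : parameter_space R d) :=
  ProbOn {
    prob_on_measure :> probability 'rV[R]_d R;
    prob_onE : prob_on_measure Theta = 1%E }.

(* Discrete means carried by a countable set; the topological support of such a
   measure may be uncountable. *)
Definition discrete_prob_on (R : realType) (d : nat)
    (Theta : parameter_space R d) : set (prob_on Theta) :=
  [set G | exists C : set 'rV[R]_d, countable C /\ G C = 1%E].
Arguments discrete_prob_on {R d} Theta.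

Section mixture.
Context (R : realType) (d1 d2 : nat) (X : sample_space R d1)
  (Theta : parameter_space R d2).
Variables (f : density_kernel X Theta) (G : prob_on Theta).
Local Open Scope ereal_scope.

Definition mixture_density (x : 'rV[R]_d1) : \bar R :=
  \int[G]_(theta in Theta) (f x theta)%:E.

Definition mixture_measure (A : set 'rV[R]_d1) : \bar R :=
  \int[base_measure X]_(x in A `&` X) mixture_density x.

Let mTheta : measurable (Theta : set _).
Proof. by apply: compact_measurable_rV; exact: parameter_set_compact. Qed.

Let mX : measurable (X : set _).
Proof. exact: measurable_sample_set. Qed.

Let F : 'rV[R]_d1 * 'rV[R]_d2 -> \bar R :=
  (fun z => (f z.1 z.2)%:E) \_ (X `*` Theta).

Let F_ge0 z : 0 <= F z.
Proof.
rewrite /F patchE; case: ifPn => //; rewrite inE => -[Xz Tz].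
by rewrite lee_fin kernel_ge0.
Qed.

Let mF : measurable_fun [set: 'rV[R]_d1 * 'rV[R]_d2] F.
Proof.
apply/(measurable_restrictT _ (measurableX mX mTheta)).
by apply/measurable_EFinP; exact: kernel_measurable.
Qed.

Lemma mixture_density_ge0 x : sample_set X x -> 0 <= mixture_density x.
Proof.
by move=> Xx; apply: integral_ge0 => t Tt; rewrite lee_fin kernel_ge0.
Qed.

Let FE x : fubini_F G F x = (mixture_density \_ X) x.
Proof.
rewrite /fubini_F /mixture_density patchE; case: ifPn => Xx.
  rewrite [RHS]integral_mkcond; apply: eq_integral => t _.
  by rewrite /F !patchE in_setX/= Xx.
by rewrite integral0_eq// => t _; rewrite /F patchE in_setX/= (negPf Xx).
Qed.

Lemma measurable_mixture_density : measurable_fun X mixture_density.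
Proof.
apply/(measurable_restrictT _ mX).
rewrite -(_ : fubini_F G F = mixture_density \_ X); last exact/funext/FE.
exact: measurable_fun_fubini_tonelli_F.
Qed.

Let mixture_measure0 : mixture_measure set0 = 0.
Proof. by rewrite /mixture_measure set0I integral_set0. Qed.

Let mixture_measure_ge0 A : 0 <= mixture_measure A.
Proof. by apply: integral_ge0 => x [_ Xx]; exact: mixture_density_ge0. Qed.

Let mixture_measure_sigma_additive : semi_sigma_additive mixture_measure.
Proof.
move=> A mA tA mUA; rewrite /mixture_measure setI_bigcupl.
rewrite ge0_integral_bigcup//=.
- apply: is_cvg_ereal_nneg_natsum_cond => n _ _.
  by apply: integral_ge0 => x [_ Xx]; exact: mixture_density_ge0.
- by move=> k; exact: measurableI.
- apply: measurable_funS measurable_mixture_density => //.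
  by move=> x [n _ []].
- by move=> x [n _ [_ Xx]]; exact: mixture_density_ge0.
- exact: trivIset_setIr.
Qed.

HB.instance Definition _ := isMeasure.Build _ _ _ mixture_measure
  mixture_measure0 mixture_measure_ge0 mixture_measure_sigma_additive.

Let mixture_measure_setT : mixture_measure setT = 1.
Proof.
rewrite /mixture_measure setTI integral_mkcond.
under eq_integral do rewrite -FE.
rewrite -(fubini_tonelli1 (m1 := base_measure X))// fubini_tonelli2//.
transitivity (\int[G]_(theta in Theta) 1).
  rewrite [RHS]integral_mkcond; apply: eq_integral => t _.
  rewrite /fubini_G patchE; case: ifPn => Tt.
    rewrite -(kernel_int1 f (set_mem Tt)) [RHS]integral_mkcond.
    by apply: eq_integral => x _; rewrite /F !patchE in_setX/= Tt andbT.
  rewrite integral0_eq// => x _.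
  by rewrite /F patchE in_setX/= (negPf Tt) andbF.
by rewrite integral_cst// mul1e; exact: prob_onE.
Qed.

HB.instance Definition _ :=
  Measure_isProbability.Build _ _ _ mixture_measure mixture_measure_setT.

Definition mixture_prob : probability 'rV[R]_d1 R := mixture_measure.

End mixture.

(* The norm that the library puts on 'rV[R]_d is the sup norm. *)
Definition euclidean_dist (R : realType) (d : nat) (u v : 'rV[R]_d) : R :=
  Num.sqrt (\sum_(i < d) (u ord0 i - v ord0 i) ^+ 2).

Definition is_coupling (R : realType) (d : nat) (G1 G2 : probability 'rV[R]_d R)
    (p : probability ('rV[R]_d * 'rV[R]_d)%type R) : Prop :=
  forall A, measurable A -> p (A `*` setT) = G1 A /\ p (setT `*` A) = G2 A.

(* A coupling of two measures carried by Theta is carried by Theta x Theta. *)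
Definition wasserstein1 (R : realType) (d : nat) (Theta : parameter_space R d)
    (G1 G2 : prob_on Theta) : \bar R :=
  ereal_inf [set (\int[p]_z (euclidean_dist z.1 z.2)%:E)%E
            | p in is_coupling G1 G2].

Definition sample_power (R : realType) (d : nat) (X : sample_space R d)
    (n : nat) : set (n.-tuple 'rV[R]_d) :=
  [set x | forall i, sample_set X (tnth x i)].
Arguments sample_power {R d} X n.

(* Measurability is with respect to the sigma-algebra generated by the
   evaluations G |-> G A, which for the compact set Theta is the Borel
   sigma-algebra of the Wasserstein metric.  The values of an estimator outside
   X^n are irrelevant. *)
Definition estimators (R : realType) (d1 d2 : nat) (X : sample_space R d1)
    (Theta : parameter_space R d2) (n : nat) :
    set (n.-tuple 'rV[R]_d1 -> prob_on Theta) :=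
  [set Ghat |
    measurable_fun (sample_power X n)
      (fun x => prob_on_measure (Ghat x) : pprobability 'rV[R]_d2 R) /\
    forall x, sample_power X n x -> discrete_prob_on Theta (Ghat x)].
Arguments estimators {R d1 d2} X Theta n.

Definition wasserstein1_risk (R : realType) (d1 d2 : nat)
    (X : sample_space R d1) (Theta : parameter_space R d2)
    (f : density_kernel X Theta) (n : nat)
    (Ghat : n.-tuple 'rV[R]_d1 -> prob_on Theta) (G : prob_on Theta) : \bar R :=
  (\int[prob_power (mixture_prob f G) n]_(x in sample_power X n)
    wasserstein1 (Ghat x) G)%E.

(* Main.v *)
From HB Require Import structures.
Require Import Defs.
From mathcomp Require Import all_boot all_order all_algebra.
From mathcomp Require Import all_classical all_reals all_analysis.
From mathcomp Require Import finmap measurable_realfun ring lra.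
Import Order.TTheory GRing.Theory Num.Theory.
Import numFieldNormedType.Exports.
Local Open Scope classical_set_scope.
Local Open Scope ring_scope.
Set Implicit Arguments.
Unset Strict Implicit.
Unset Printing Implicit Defensive.

(** The bound is a two-point argument.  Since [G1] and [G2] need not be discrete,
    they are replaced by their images under maps that round [Theta] to finitely
    many of its points, with a mesh tending to 0.  The kernel is continuous in
    the parameter on a compact set, so the densities of both rounded mixtures
    converge almost everywhere to the density that the mixtures of [G1] and [G2]
    share, and by dominated convergence the integral of their minimum tends to 1
    ([cvg_integral_min_density]).  Normalizing that minimum gives a probability
    [Q] with [a * Q <= P_1] and [a * Q <= P_2], where [P_1] and [P_2] are the
    rounded mixtures and [a] is as close to 1 as desired
    ([exists_common_part]).  Domination passes to powers: [a ^ n * Q^n <= P_i^n]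
    ([le_prob_power]).  The two risks of an estimator therefore add up to at
    least [a ^ n] times the [Q^n]-mean of the sum of its two losses, and by the
    triangle inequality that sum is almost [W1 (G1, G2)].  The larger risk is thus
    at least almost half of [W1 (G1, G2)], and crude choices of the parameters
    leave more than the fraction 3/32.

    Adding the two integrals requires measurable integrands, and the definition
    of the loss as an infimum over couplings gives no measurability in the
    sample.  The losses are therefore bounded from below by functions that depend
    on the sample only through finitely many thresholds of the masses that the
    estimate gives to the cells of the quantizer ([measurable_loss_minorants]).
    Two samples in the same class may have different estimates, so the triangle
    inequality is needed in an approximate form, with two middle measures whose
    cell masses almost agree ([wasserstein1_le_couplings]).  It is proved with
    matrices: couplings are collapsed to transport plans between the cells
    ([coupling_to_plan]), plans with almost equal marginals are glued
    ([glue_plans]), and a plan is spread out to a coupling of [G1] and [G2] by a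
    density with respect to their product ([plan_to_coupling]).  No duality
    theorem and no disintegration is involved. *)

(** * The Euclidean distance *)

Section euclidean.
Context (R : realType) (d : nat).
Implicit Types u v w : 'rV[R]_d.

Lemma euclidean_dist_ge0 u v : 0 <= euclidean_dist u v.
Proof. exact: sqrtr_ge0. Qed.

Lemma euclidean_distC u v : euclidean_dist u v = euclidean_dist v u.
Proof. by congr Num.sqrt; apply: eq_bigr => i _; rewrite -sqrrN opprB. Qed.

Lemma cauchy_schwarz_sum (a b : 'I_d -> R) :
  \sum_i a i * b i <=
  Num.sqrt (\sum_i a i ^+ 2) * Num.sqrt (\sum_i b i ^+ 2).
Proof.
set A := \sum_i a i ^+ 2; set B := \sum_i b i ^+ 2.
have A0 : 0 <= A by apply: sumr_ge0 => i _; exact: sqr_ge0.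
have B0 : 0 <= B by apply: sumr_ge0 => i _; exact: sqr_ge0.
have zero (c e : 'I_d -> R) :
    \sum_i c i ^+ 2 = 0 -> \sum_i c i * e i = 0.
  move=> /eqP; rewrite psumr_eq0; last by move=> i _; exact: sqr_ge0.
  move=> /allP c0; apply: big1 => i _.
  by have := c0 i (mem_index_enum i); rewrite /= sqrf_eq0 => /eqP ->; rewrite mul0r.
have [A00|An0] := eqVneq A 0; first by rewrite zero// mulr_ge0// sqrtr_ge0.
have [B00|Bn0] := eqVneq B 0.
  rewrite (eq_bigr (fun i => b i * a i)); last by move=> i _; rewrite mulrC.
  by rewrite zero// mulr_ge0// sqrtr_ge0.
have sA : 0 < Num.sqrt A by rewrite sqrtr_gt0 lt0r An0.
have sB : 0 < Num.sqrt B by rewrite sqrtr_gt0 lt0r Bn0.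
rewrite -[leRHS]mul1r -ler_pdivrMr ?mulr_gt0// mulr_suml.
(* arithmetic-geometric mean, term by term *)
apply: (@le_trans _ _
  (\sum_i (a i ^+ 2 / A + b i ^+ 2 / B) / 2)).
  apply: ler_sum => i _; rewrite -[X in a i ^+ 2 / X](sqr_sqrtr A0).
  rewrite -[X in b i ^+ 2 / X](sqr_sqrtr B0) -subr_ge0.
  rewrite [leRHS](_ : _ = (a i / Num.sqrt A - b i / Num.sqrt B) ^+ 2 / 2).
    by rewrite divr_ge0// sqr_ge0.
  by field; rewrite !lt0r_neq0.
by rewrite -mulr_suml big_split/= -!mulr_suml !divff//.
Qed.

Lemma euclidean_dist_triangle v u w :
  euclidean_dist u w <= euclidean_dist u v + euclidean_dist v w.
Proof.
rewrite /euclidean_dist.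
pose a i := u ord0 i - v ord0 i; pose b i := v ord0 i - w ord0 i.
have A0 : 0 <= \sum_i a i ^+ 2 by apply: sumr_ge0 => i _; exact: sqr_ge0.
have B0 : 0 <= \sum_i b i ^+ 2 by apply: sumr_ge0 => i _; exact: sqr_ge0.
rewrite -[leRHS]ger0_norm ?addr_ge0 ?sqrtr_ge0// -sqrtr_sqr ler_wsqrtr//.
have -> : \sum_i (u ord0 i - w ord0 i) ^+ 2 =
    \sum_i a i ^+ 2 + (\sum_i a i * b i) *+ 2 + \sum_i b i ^+ 2.
  rewrite -sumrMnl -!big_split; apply: eq_bigr => i _.
  by rewrite /= -sqrrD /a /b addrA subrK.
rewrite sqrrD !sqr_sqrtr// lerD2r lerD2l lerMn2r/=.
exact: cauchy_schwarz_sum.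
Qed.

(** The topology of row vectors is given by the sup norm; this is the comparison
    of the two norms, with a constant that is not sharp. *)
Lemma euclidean_dist_ball u v e : ball u e v -> euclidean_dist u v <= d%:R * e.
Proof.
move=> [e0 uv].
have d0 : 0 <= d%:R * e :> R by rewrite mulr_ge0// ltW.
rewrite -[leRHS]ger0_norm// -sqrtr_sqr ler_wsqrtr//.
apply: (@le_trans _ _ (\sum_(i < d) e ^+ 2)).
  apply: ler_sum => i _; have := uv ord0 i; rewrite /ball/= => /ltW uve.
  by rewrite -[leLHS]real_normK ?num_real// ler_pXn2r ?nnegrE// ltW.
rewrite sumr_const card_ord -[leLHS]mulr_natl exprMn ler_wpM2r ?sqr_ge0//.
by rewrite -natrX ler_nat; case: (d) => // k; rewrite leq_pmulr.
Qed.

Lemma measurable_coord_rV i : measurable_fun setT (fun u : 'rV[R]_d => u ord0 i).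
Proof.
apply: (measurability _ (RGenOpens.measurableE R)) => _ [_ [a [b ->] <-]].
rewrite setTI; apply: sub_sigma_algebra.
by apply: open_comp => // u _; exact: coord_continuous.
Qed.

Lemma measurable_euclidean_dist :
  measurable_fun setT (fun z : 'rV[R]_d * 'rV[R]_d => euclidean_dist z.1 z.2).
Proof.
have msqrt : measurable_fun setT (Num.sqrt : R -> R).
  by apply: continuous_measurable_fun; exact: sqrt_continuous.
apply: (measurableT_comp msqrt).
apply: measurable_sum => i; apply: (measurable_funX 2).
by apply: measurable_funB; apply: (measurableT_comp (measurable_coord_rV i)).
Qed.

Lemma measurable_set1_rV u : measurable [set u].
Proof. exact: (compact_measurable_rV (@compact_set1 _ u)). Qed.

End euclidean.

(** * Finite quantizers of the parameter space *)

Section quantizer.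
Context (R : realType) (d : nat) (Theta : parameter_space R d).

Lemma measurable_parameter_set : measurable (Theta : set 'rV[R]_d).
Proof. by apply: compact_measurable_rV; exact: parameter_set_compact. Qed.

(** The centers are distinct so that the masses of the atoms of a rounded measure
    are exactly the masses of the cells.  A center need not lie in the cell that
    is sent to it. *)
Record quantizer := Quantizer {
  q_index : finType;
  center : q_index -> 'rV[R]_d;
  cell_of : 'rV[R]_d -> q_index;
  center_inj : injective center;
  center_in : forall i, parameter_set Theta (center i);
  measurable_cell_of : forall i, measurable (cell_of @^-1` [set i]) }.

Definition rounding (q : quantizer) (theta : 'rV[R]_d) : 'rV[R]_d :=
  center (cell_of q theta).

Definition mesh_lt (q : quantizer) (e : R) : Prop :=
  forall theta, parameter_set Theta theta -> ball (rounding q theta) e theta.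

Lemma measurable_preimage_finite d1 (T : measurableType d1) (D : set T)
    (I : finType) (J : T -> I) (Y : set I) :
  (forall i, measurable (D `&` J @^-1` [set i])) ->
  measurable (D `&` J @^-1` Y).
Proof.
move=> mJ; rewrite (_ : _ `&` _ = \bigcup_(i in Y) (D `&` J @^-1` [set i])).
  by apply: fin_bigcup_measurable => //; exact: finite_finset.
apply/seteqP; split=> [x [Dx Yx]|x [i Yi [Dx /= Jx]]]; first by exists (J x).
by split=> //=; rewrite /preimage/= Jx.
Qed.

(** A map with finitely many values is measurable as soon as its level sets are,
    whatever is done afterwards to these values. *)
Lemma measurable_finite_factor d1 d2 (T : measurableType d1)
    (U : measurableType d2) (D : set T) (I : finType) (J : T -> I) (g : I -> U) :
  (forall i, measurable (D `&` J @^-1` [set i])) ->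
  measurable_fun D (g \o J).
Proof.
move=> mJ _ Y _; rewrite comp_preimage; exact: measurable_preimage_finite.
Qed.

Lemma measurable_rounding (q : quantizer) : measurable_fun setT (rounding q).
Proof.
apply: (@measurable_finite_factor _ _ _ _ _ _ (cell_of q) (@center q)) => i.
by rewrite setTI; exact: measurable_cell_of.
Qed.

(** Taking the first set that contains the point turns a cover into a partition;
    [i0] is the value at the points that no set contains. *)
Definition first_hit (I : eqType) (B : I -> set 'rV[R]_d) (i0 : I) (s : seq I)
    (theta : 'rV[R]_d) : I :=
  foldr (fun i j => if theta \in B i then i else j) i0 s.

Lemma first_hit_in (I : eqType) B (i0 : I) s theta i :
  i \in s -> B i theta -> B (first_hit B i0 s theta) theta.
Proof.
elim: s => //= j s IHs; rewrite inE.
case: ifPn => [/set_mem//|jB /predU1P[->|//] Bj].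
by rewrite (mem_set Bj) in jB.
Qed.

Lemma measurable_first_hit (I : eqType) (B : I -> set 'rV[R]_d) (i0 : I) s i :
  (forall j, measurable (B j)) -> measurable (first_hit B i0 s @^-1` [set i]).
Proof.
move=> mB.
have mP (P : Prop) : measurable [set _ : 'rV[R]_d | P].
  have [p|np] := pselect P.
    by have -> : [set _ : 'rV[R]_d | P] = setT by apply/seteqP; split.
  by have -> : [set _ : 'rV[R]_d | P] = set0 by apply/seteqP; split.
elim: s => [|j s IHs]; rewrite /preimage/=; first exact: (mP (i0 = i)).
rewrite (_ : mkset _ = (B j `&` [set _ | j = i]) `|`
    (~` B j `&` first_hit B i0 s @^-1` [set i])).
  apply: measurableU; first by apply: measurableI; [exact: mB|exact: mP].
  by apply: measurableI; [apply: measurableC; exact: mB|exact: IHs].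
apply/seteqP; split=> x /=; (have [Bx|Bx] := pselect (B j x);
  first rewrite mem_set//; last rewrite memNset//).
- by left.
- by right.
- by case=> [[]|[]].
- by case=> [[]|[]].
Qed.

Lemma exists_quantizer (e : R) : 0 < e -> exists q : quantizer, mesh_lt q e.
Proof.
move=> e0; have := @parameter_set_compact _ _ Theta; rewrite compact_cover.
move=> /(_ _ Theta (fun c => (ball c e)°)); case.
- by move=> c _; exact: open_interior.
- by move=> c Tc; exists c => //; exact: nbhsx_ballx.
move=> s sT cov.
have [c0 c0T] : (Theta : set _) !=set0.
  by case: (parameter_set_interior Theta) => c /interior_subset; exists c.
have [c1 c1s _] := cov _ c0T.
pose I : finType := seq_sub (enum_fset s).
pose i0 : I := SeqSub c1s.
pose B (i : I) : set 'rV[R]_d := (ball (ssval i) e)°.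
have cT (i : I) : parameter_set Theta (ssval i) by apply/set_mem/sT/(ssvalP i).
have mB i : measurable (B i).
  by apply: sub_sigma_algebra; exact: open_interior.
exists (Quantizer val_inj cT
  (fun i => measurable_first_hit i0 (enum I) i mB)) => theta Tt.
have [c cs ct] := cov _ Tt; apply: interior_subset.
have ics : SeqSub cs \in enum I by rewrite mem_enum.
exact: (@first_hit_in I B i0 (enum I) theta (SeqSub cs) ics ct).
Qed.

End quantizer.

(** * Finite transport plans *)

Section finite_transport.
Context (R : realFieldType) (I : finType).
Implicit Types (h g : I -> R) (M c : I -> I -> R).

Definition transport_plan h g M : Prop :=
  [/\ forall i j, 0 <= M i j, forall i, \sum_j M i j = h i &
      forall j, \sum_i M i j = g j].

Definition plan_cost c M : R := \sum_i \sum_j M i j * c i j.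

(** A nonnegative matrix whose marginals are too small becomes a plan when the
    product of the two missing marginals, divided by the missing mass, is added.
    If no mass is missing then the missing marginals vanish, so that the division
    by zero is harmless. *)
Lemma complete_plan g1 g2 S c D :
  (forall i j, 0 <= S i j) ->
  (forall i, \sum_j S i j <= g1 i) -> (forall j, \sum_i S i j <= g2 j) ->
  \sum_i g1 i = \sum_j g2 j -> (forall i j, c i j <= D) ->
  exists2 M, transport_plan g1 g2 M &
    plan_cost c M <=
    plan_cost c S + D * (\sum_i g1 i - \sum_i \sum_j S i j).
Proof.
move=> S0 Sg1 Sg2 g12 cD.
set del := \sum_i g1 i - _.
pose a i := g1 i - \sum_j S i j; pose b j := g2 j - \sum_i S i j.
have a0 i : 0 <= a i by rewrite subr_ge0.
have b0 i : 0 <= b i by rewrite subr_ge0.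
have suma : \sum_i a i = del by rewrite /del /a sumrB.
have sumb : \sum_i b i = del by rewrite /del /b sumrB -g12 exchange_big.
have del0 : 0 <= del by rewrite -suma sumr_ge0.
have adel i : a i * del / del = a i.
  have [d0|dn0] := eqVneq del 0; last by rewrite mulfK.
  move/eqP: suma; rewrite d0 psumr_eq0// => /allP/(_ i (mem_index_enum i)).
  by rewrite /= => /eqP ->; rewrite !mul0r.
have bdel i : b i * del / del = b i.
  have [d0|dn0] := eqVneq del 0; last by rewrite mulfK.
  move/eqP: sumb; rewrite d0 psumr_eq0// => /allP/(_ i (mem_index_enum i)).
  by rewrite /= => /eqP ->; rewrite !mul0r.
exists (fun i j => S i j + a i * b j / del).
  split.
  - by move=> i j; rewrite addr_ge0// divr_ge0// mulr_ge0.
  - move=> i; rewrite big_split/= -mulr_suml -mulr_sumr sumb adel.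
    by rewrite addrC subrK.
  - move=> j; rewrite big_split/= -!mulr_suml suma (mulrC del) bdel.
    by rewrite addrC subrK.
rewrite /plan_cost.
under eq_bigr do (under eq_bigr do rewrite mulrDl; rewrite big_split/=).
rewrite big_split/= lerD2l.
apply: (@le_trans _ _ (\sum_i \sum_j (a i * b j / del) * D)).
  apply: ler_sum => i _; apply: ler_sum => j _; rewrite ler_wpM2l//.
  by rewrite divr_ge0// mulr_ge0.
under eq_bigr do rewrite -!mulr_suml -mulr_sumr sumb adel.
by rewrite -mulr_suml suma mulrC.
Qed.

(** With equal first marginals [h] the plans compose as the Markov kernels
    [M1 l i / h l] and [M2 l j / h l] weighted by [h l].  When the marginals
    differ, dividing by their maximum keeps all marginals of the composition small
    enough for [complete_plan], and the missing mass is at most the l1 distance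
    of [h1] and [h2]. *)
Lemma glue_plans h1 h2 g1 g2 M1 M2 c D k :
  transport_plan h1 g1 M1 -> transport_plan h2 g2 M2 ->
  \sum_i h1 i = 1 -> \sum_i h2 i = 1 -> (forall i, `|h1 i - h2 i| <= k) ->
  (forall i j, 0 <= c i j <= D) ->
  (forall l i j, c i j <= c l i + c l j) ->
  exists2 M, transport_plan g1 g2 M &
    plan_cost c M <= plan_cost c M1 + plan_cost c M2 + D * (#|I|%:R * k).
Proof.
move=> [M10 M1h M1g] [M20 M2h M2g] h11 h21 h12 cD ctri.
have h10 l : 0 <= h1 l by rewrite -M1h sumr_ge0.
have h20 l : 0 <= h2 l by rewrite -M2h sumr_ge0.
pose m l := Num.max (h1 l) (h2 l).
have m0 l : 0 <= m l by rewrite le_max h10.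
have ratio1 l : h1 l / m l <= 1.
  have [e0|n0] := eqVneq (m l) 0; first by rewrite e0 invr0 mulr0.
  rewrite ler_pdivrMr ?mul1r; last by rewrite lt0r n0 m0.
  by rewrite le_max lexx.
have ratio2 l : h2 l / m l <= 1.
  have [e0|n0] := eqVneq (m l) 0; first by rewrite e0 invr0 mulr0.
  rewrite ler_pdivrMr ?mul1r; last by rewrite lt0r n0 m0.
  by rewrite le_max lexx orbT.
pose S i j := \sum_l M1 l i * M2 l j / m l.
have S0 i j : 0 <= S i j.
  by rewrite sumr_ge0// => l _; rewrite divr_ge0// mulr_ge0.
have Sr i : \sum_j S i j = \sum_l M1 l i * (h2 l / m l).
  rewrite exchange_big; apply: eq_bigr => l _ /=.
  by rewrite -mulr_suml -mulr_sumr M2h mulrA.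
have Sc j : \sum_i S i j = \sum_l M2 l j * (h1 l / m l).
  rewrite exchange_big; apply: eq_bigr => l _ /=.
  by rewrite -!mulr_suml M1h mulrAC mulrC.
have sumg1 : \sum_i g1 i = 1.
  by rewrite -h11 -(eq_bigr _ (fun i _ => M1g i)) exchange_big;
    apply: eq_bigr => i _; exact: M1h.
have sumg2 : \sum_i g2 i = 1.
  by rewrite -h21 -(eq_bigr _ (fun i _ => M2g i)) exchange_big;
    apply: eq_bigr => i _; exact: M2h.
have [|||i j|M planM costM] := @complete_plan g1 g2 S c D S0.
- by move=> i; rewrite Sr -M1g; apply: ler_sum => l _; rewrite ler_piMr.
- by move=> i; rewrite Sc -M2g; apply: ler_sum => l _; rewrite ler_piMr.
- by rewrite sumg1.
- by have /andP[] := cD i j.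
exists M => //; apply: (le_trans costM); apply: lerD.
  rewrite /plan_cost /S.
  apply: (@le_trans _ _ (\sum_i \sum_j \sum_l
      ((M1 l i * c l i) * (M2 l j / m l) + (M2 l j * c l j) * (M1 l i / m l)))).
    apply: ler_sum => i _; apply: ler_sum => j _; rewrite mulr_suml.
    apply: ler_sum => l _.
    rewrite [leRHS](_ : _ = M1 l i * M2 l j / m l * (c l i + c l j)).
      by rewrite ler_wpM2l// divr_ge0// mulr_ge0.
    by ring.
  rewrite (eq_bigr (fun i => \sum_l \sum_j
    ((M1 l i * c l i) * (M2 l j / m l) + (M2 l j * c l j) * (M1 l i / m l))));
    last by move=> i _; rewrite exchange_big.
  rewrite exchange_big/= -big_split/=; apply: ler_sum => l _.
  under eq_bigr do rewrite big_split/=.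
  rewrite big_split/=; apply: lerD.
    apply: ler_sum => i _; rewrite -mulr_sumr -mulr_suml M2h ler_piMr//.
    by rewrite mulr_ge0//; have /andP[] := cD l i.
  rewrite exchange_big/=; apply: ler_sum => j _.
  rewrite -mulr_sumr -mulr_suml M1h ler_piMr//.
  by rewrite mulr_ge0//; have /andP[] := cD l j.
have [l0|I0] := pickP (@predT I); last first.
  have z (F : I -> R) : \sum_i F i = 0.
    by apply: big1 => i _; have := I0 i.
  by move: h11; rewrite z => /eqP; rewrite eq_sym oner_eq0.
rewrite ler_wpM2l//; first by have /andP[] := cD l0 l0; exact: le_trans.
rewrite sumg1; under eq_bigr do rewrite Sr.
rewrite exchange_big/= mulr_natl -h11 -sumrB -sumr_const.
apply: ler_sum => l _; rewrite -mulr_suml M1h.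
apply: le_trans (h12 l).
have [h21l|h12l] := leP (h2 l) (h1 l).
  rewrite /m max_l// ger0_norm ?subr_ge0// lerD2l lerN2.
  have [e0|n0] := eqVneq (h1 l) 0; first by rewrite e0 mul0r -e0.
  by rewrite mulrCA mulfV// mulr1.
have h2p : 0 < h2 l by exact: le_lt_trans h12l.
rewrite /m max_r; last exact: ltW.
rewrite divff; last by rewrite gt_eqF.
by rewrite mulr1 subrr.
Qed.

End finite_transport.

(** * Finite partitions and densities *)

Section measure_tools.
Local Open Scope ereal_scope.
Context d (T : measurableType d) (R : realType).
Implicit Types (mu : {measure set T -> \bar R}) (f : T -> \bar R).

Lemma ge0_integral_partition mu (I : finType) (F : I -> set T) f :
  (forall i, measurable (F i)) -> trivIset setT F ->
  measurable_fun (\bigcup_i F i) f ->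
  (forall x, (\bigcup_i F i) x -> 0 <= f x) ->
  \int[mu]_(x in \bigcup_i F i) f x = \sum_i \int[mu]_(x in F i) f x.
Proof.
move=> mF tF mf f0.
have UE : \bigcup_i F i = \big[setU/set0]_(i <- index_enum I) F i.
  rewrite -bigcup_seq; apply/seteqP; split => x [i _ Fx]; exists i => //.
  by rewrite /= mem_index_enum.
rewrite UE ge0_integral_bigsetU// -?UE//.
- by rewrite /index_enum; case: index_enum_key; rewrite -enumT enum_uniq.
- exact: sub_trivIset tF.
Qed.

Lemma measure_partition mu (I : finType) (F : I -> set T) :
  (forall i, measurable (F i)) -> trivIset setT F ->
  mu (\bigcup_i F i) = \sum_i mu (F i).
Proof.
move=> mF tF.
have mU : measurable (\bigcup_i F i).
  by apply: fin_bigcup_measurable => //; exact: finite_finset.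
rewrite -[LHS]mul1e -integral_cst//= ge0_integral_partition//.
by apply: eq_bigr => i _; rewrite integral_cst// mul1e.
Qed.

Lemma measure_eq_null mu (A B : set T) : measurable A -> measurable B ->
  A `<=` B -> mu (B `\` A) = 0 -> mu A = mu B.
Proof.
move=> mA mB AB BA0; rewrite -[in RHS](setDUK AB).
by rewrite measureU0//; exact: measurableD.
Qed.

(** Serves for the coupling built from a transport plan and for the common part of
    two mixtures. *)
Lemma exists_density_measure mu f : measurable_fun setT f ->
  (forall x, 0 <= f x) ->
  exists nu : {measure set T -> \bar R},
    forall A, nu A = \int[mu]_(x in A) f x.
Proof.
move=> mf f0; pose nu A := \int[mu]_(x in A) f x.
have nu0 : nu set0 = 0 by exact: integral_set0.
have nuge A : 0 <= nu A by exact: integral_ge0.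
have nus : semi_sigma_additive nu.
  move=> A mA tA mUA; rewrite /nu ge0_integral_bigcup//=; last first.
    exact: measurable_funTS.
  by apply: is_cvg_ereal_nneg_natsum_cond => n _ _; exact: integral_ge0.
pose m := isMeasure.Build _ _ _ nu nu0 nuge nus.
by exists (HB.pack_for {measure set T -> \bar R} nu m).
Qed.

Lemma exists_density_prob mu f : measurable_fun setT f ->
  (forall x, 0 <= f x) -> \int[mu]_x f x = 1 ->
  exists P : probability T R, forall A, P A = \int[mu]_(x in A) f x.
Proof.
move=> mf f0 f1; have [nu nuE] := exists_density_measure mu mf f0.
have nu1 : nu setT = 1 by rewrite nuE.
exists (mnormalize nu (dirac point)) => A.
by rewrite /= /mnormalize nu1 onee_eq0/= invr1 mule1.
Qed.

End measure_tools.

(** * Couplings and transport plans *)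

Section quantized_measure.
Context (R : realType) (d : nat) (Theta : parameter_space R d).
Implicit Types (q : quantizer Theta) (G H : prob_on Theta).

Lemma prob_on_setC G : G (~` (Theta : set _)) = 0%E.
Proof.
rewrite probability_setC; last exact: measurable_parameter_set.
by rewrite prob_onE subee.
Qed.

HB.instance Definition _ q := isMeasurableFun.Build _ _ _ _
  (rounding q) (measurable_rounding q).

Definition quantized_prob q G : probability 'rV[R]_d R :=
  distribution G (rounding q).

Lemma quantized_prob_on q G : quantized_prob q G Theta = 1%E.
Proof.
have -> : quantized_prob q G Theta = G (rounding q @^-1` Theta) by [].
have -> : rounding q @^-1` Theta = setT.
  by apply/seteqP; split => // x _; exact: center_in.
exact: probability_setT.
Qed.

Definition quantized q G : prob_on Theta := ProbOn (quantized_prob_on q G).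

Lemma quantizedE q G (A : set 'rV[R]_d) : quantized q G A = G (rounding q @^-1` A).
Proof. by []. Qed.

Lemma quantized_discrete q G : discrete_prob_on Theta (quantized q G).
Proof.
exists (range (@center _ _ _ q)); split.
  by apply: finite_set_countable; apply: finite_image; exact: finite_finset.
rewrite quantizedE (_ : _ @^-1` _ = setT) ?probability_setT//.
by apply/seteqP; split => // x _; exists (cell_of q x).
Qed.

Definition mass q G (i : q_index q) : R := fine (G (cell_of q @^-1` [set i])).
Arguments mass q G i : clear implicits.

Lemma mass_ge0 q G i : 0 <= mass q G i.
Proof. exact: fine_ge0. Qed.

Lemma massE q G i : (mass q G i)%:E = G (cell_of q @^-1` [set i]).
Proof. by rewrite fineK// fin_num_measure//; exact: measurable_cell_of. Qed.

Lemma trivIset_cell_of q : trivIset setT (fun i => cell_of q @^-1` [set i]).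
Proof. by move=> i j _ _ [x [/= <- <-]]. Qed.

Lemma sum_mass q G : \sum_i mass q G i = 1.
Proof.
apply/EFin_inj; rewrite -sumEFin.
under eq_bigr do rewrite massE.
rewrite -(measure_partition G (@measurable_cell_of _ _ _ q)); last first.
  exact: trivIset_cell_of.
have -> : \bigcup_i cell_of q @^-1` [set i] = setT.
  by apply/seteqP; split => // x _; exists (cell_of q x).
exact: probability_setT.
Qed.

Definition center_dist q (i j : q_index q) : R :=
  euclidean_dist (center i) (center j).

End quantized_measure.
Arguments mass {R d Theta} q G i.
Arguments center_dist {R d Theta} q i j.

Section couplings.
Context (R : realType) (d : nat) (Theta : parameter_space R d).
Variables (q : quantizer Theta) (e : R).
Hypothesis rounding_close : forall theta, parameter_set Theta theta ->
  euclidean_dist theta (rounding q theta) <= e.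
Implicit Types (G H : prob_on Theta).
Let dist (z : 'rV[R]_d * 'rV[R]_d) : \bar R := (euclidean_dist z.1 z.2)%:E.

Let dist_ge0 z : (0 <= dist z)%E.
Proof. by rewrite lee_fin euclidean_dist_ge0. Qed.

Let mdist D : measurable_fun D dist.
Proof.
by apply/measurable_funTS/measurable_EFinP; exact: measurable_euclidean_dist.
Qed.

Let mTheta : measurable (Theta : set 'rV[R]_d).
Proof. exact: measurable_parameter_set. Qed.

Let N (i : q_index q) := cell_of q @^-1` [set i].

Let mN i : measurable (N i).
Proof. exact: measurable_cell_of. Qed.

Let e0 : 0 <= e.
Proof.
case: (parameter_set_interior Theta) => c /interior_subset /rounding_close.
by apply: le_trans; exact: euclidean_dist_ge0.
Qed.

(** The entry [(i, j)] is the mass of the rectangle made of the cell [i] and of the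
    atom at the center [j].  Only the first coordinate is moved, by at most [e],
    because the second measure is already carried by the centers. *)
Lemma coupling_to_plan H G (p : probability ('rV[R]_d * 'rV[R]_d)%type R) :
  is_coupling H (quantized q G) p ->
  exists2 M, transport_plan (mass q H) (mass q G) M &
    ((plan_cost (center_dist q) M)%:E <= \int[p]_z dist z + e%:E)%E.
Proof.
move=> cpl.
have pH A : measurable A -> p (A `*` setT) = H A by move=> /cpl[].
have pG A : measurable A -> p (setT `*` A) = quantized q G A by move=> /cpl[].
have mrange : measurable (range (@center _ _ _ q)).
  rewrite (_ : range _ = \bigcup_(i : q_index q) [set center i]).
    apply: fin_bigcup_measurable; first exact: finite_finset.
    by move=> i _; exact: measurable_set1_rV.
  apply/seteqP; split=> x; first by move=> [i _ <-]; exists i.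
  by move=> [i _ ->]; exists i.
pose F (ij : q_index q * q_index q) := N ij.1 `*` [set center ij.2].
have mF ij : measurable (F ij).
  by apply: measurableX => //; exact: measurable_set1_rV.
have tF : trivIset setT F.
  move=> [i j] [i' j'] _ _ [[x y] [[/= Nx yj] [/= N'x yj']]].
  by rewrite -Nx -N'x -(center_inj (etrans (esym yj) yj')).
pose M i j := fine (p (F (i, j))).
have ME i j : (M i j)%:E = p (F (i, j)) by rewrite fineK// fin_num_measure.
exists M.
  split.
  - by move=> i j; exact: fine_ge0.
  - move=> i; apply/EFin_inj; rewrite massE -sumEFin -(pH _ (mN i)).
    under eq_bigr do rewrite ME.
    rewrite -(@measure_partition _ _ _ _ _ (fun j => F (i, j)))//; last first.
      by move=> j j' _ _ /tF -/(_ I I)[].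
    apply: measure_eq_null.
    + by apply: fin_bigcup_measurable => //; exact: finite_finset.
    + by apply: measurableX => //; exact: mN.
    + by move=> z [j _ [Nz _]].
    + apply: (@subset_measure0 _ _ _ _ _ (setT `*` ~` range (@center _ _ _ q))).
      * apply: measurableD; first by apply: measurableX => //; exact: mN.
        by apply: fin_bigcup_measurable => //; exact: finite_finset.
      * by apply: measurableX => //; exact: measurableC.
      * move=> [x y] [[/= Nx _] nF]; split => //= -[j _ yj].
        by apply: nF; exists j.
      * apply: (etrans (pG _ (measurableC mrange))).
        rewrite quantizedE; have -> : rounding q @^-1`
            (~` range (@center _ _ _ q)) = set0; last exact: measure0.
        by apply/seteqP; split => // x; apply; exists (cell_of q x).
  - move=> j; apply/EFin_inj; rewrite massE -sumEFin.
    under eq_bigr do rewrite ME.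
    rewrite -(@measure_partition _ _ _ _ _ (fun i => F (i, j)))//; last first.
      by move=> i i' _ _ /tF -/(_ I I)[].
    rewrite (_ : \bigcup_i _ = setT `*` [set center j]).
      apply: (etrans (pG _ (measurable_set1_rV _))).
      rewrite quantizedE; congr (G _); apply/seteqP; split => x /=.
        by move=> /center_inj.
      by rewrite /rounding => ->.
    apply/seteqP; split => [z [i _ [_ zj]]|[x y] [_ yj]]; first by split.
    by exists (cell_of q x).
have -> : (plan_cost (center_dist q) M)%:E =
    (\sum_ij \int[p]_(z in F ij `&` (Theta `*` setT))
      (center_dist q ij.1 ij.2)%:E)%E.
  rewrite /plan_cost pair_big/= -sumEFin; apply: eq_bigr => -[i j] _ /=.
  rewrite integral_cst; last first.
    by apply: measurableI => //; apply: measurableX.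
  rewrite EFinM ME muleC; congr (_ * _)%E; apply/esym.
  apply: measure_eq_null => //.
  + by apply: measurableI => //; apply: measurableX.
  + apply: (@subset_measure0 _ _ _ _ _ (~` (Theta : set _) `*` setT)).
    * apply: measurableD => //; apply: measurableI => //; exact: measurableX.
    * by apply: measurableX => //; exact: measurableC.
    * move=> [x y] [Fxy nFT]; split => //= Tx; exact: nFT.
    * by apply: (etrans (pH _ (measurableC mTheta))); exact: prob_on_setC.
have mFT ij : measurable (F ij `&` (Theta `*` setT)).
  by apply: measurableI => //; apply: measurableX.
apply: (@le_trans _ _ (\sum_ij \int[p]_(z in F ij `&` (Theta `*` setT))
      (dist z + e%:E))%E).
  apply: lee_sum => ij _; apply: ge0_le_integral => //.
  - by move=> z _; rewrite lee_fin euclidean_dist_ge0.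
  - by apply: emeasurable_funD.
  - move=> [x y] [[/= Nx yj] [Tx _]].
    rewrite -EFinD lee_fin /center_dist -yj -Nx addrC.
    apply: (le_trans (euclidean_dist_triangle x _ _)); rewrite lerD2r.
    by rewrite euclidean_distC; exact: rounding_close.
have mde : measurable_fun setT (fun z => dist z + e%:E)%E.
  exact: emeasurable_funD.
have de0 z : (0 <= dist z + e%:E)%E by rewrite adde_ge0// lee_fin.
rewrite -(@ge0_integral_partition _ _ _ _ _
  (fun ij => F ij `&` (Theta `*` setT)))//; last 2 first.
- exact: trivIset_setIr.
- exact: measurable_funTS.
rewrite (le_trans (ge0_subset_integral _ _ _ mde _ _))//.
  by apply: fin_bigcup_measurable => //; exact: finite_finset.
rewrite ge0_integralD//.
rewrite integral_cst// [X in (_ * X)%E](_ : _ = 1%E) ?mule1//.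
exact: probability_setT.
Qed.

Variables (G1 G2 : prob_on Theta).

(** Both coordinates lie within [e] of the centers of their cells, up to a null
    set; the cost of a coupling is therefore controlled by its masses on the
    products of cells. *)
Lemma coupling_cost_le (p : probability ('rV[R]_d * 'rV[R]_d)%type R)
    (M : q_index q -> q_index q -> R) :
  is_coupling G1 G2 p -> transport_plan (mass q G1) (mass q G2) M ->
  (forall i j, p (N i `*` N j) = (M i j)%:E) ->
  (\int[p]_z dist z <= (plan_cost (center_dist q) M + 2 * e)%:E)%E.
Proof.
move=> cpl [M0 MG1 _] pM.
pose TT : set ('rV[R]_d * 'rV[R]_d) := Theta `*` Theta.
have mTT : measurable TT by exact: measurableX.
have p0 : p (~` TT) = 0%E.
  have p1 : p (~` (Theta : set _) `*` setT) = 0%E.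
    by apply: (etrans (cpl _ (measurableC mTheta)).1); exact: prob_on_setC.
  have p2 : p (setT `*` ~` (Theta : set _)) = 0%E.
    by apply: (etrans (cpl _ (measurableC mTheta)).2); exact: prob_on_setC.
  have m1 : measurable (~` (Theta : set _) `*` [set: 'rV[R]_d]).
    by apply: measurableX => //; exact: measurableC.
  have m2 : measurable ([set: 'rV[R]_d] `*` ~` (Theta : set _)).
    by apply: measurableX => //; exact: measurableC.
  apply: (subset_measure0 (B := (~` (Theta : set _) `*` setT) `|`
                                (setT `*` ~` (Theta : set _)))).
  - exact: measurableC.
  - exact: measurableU.
  - move=> [x y] /= nTT; have [Tx|nTx] := pselect (parameter_set Theta x).
      by right; split => //= Ty; exact: nTT.
    by left; split.
  - by apply: (etrans (measureU0 m1 m2 p2)); exact: p1.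
rewrite (ge0_negligible_integral (measurableC mTT))//.
rewrite setTD setCK.
pose F (ij : q_index q * q_index q) := (N ij.1 `*` N ij.2) `&` TT.
have mF ij : measurable (F ij) by apply: measurableI => //; exact: measurableX.
have tF : trivIset setT F.
  by move=> [i j] [i' j'] _ _ [[x y] [[[/= <- <-] _] [[/= <- <-] _]]].
have UF : TT = \bigcup_ij F ij.
  apply/seteqP; split => [[x y] xy|z [ij _ []]//].
  by exists (cell_of q x, cell_of q y).
rewrite UF ge0_integral_partition//.
have -> : ((plan_cost (center_dist q) M + 2 * e)%:E =
    \sum_ij (M ij.1 ij.2 * (center_dist q ij.1 ij.2 + 2 * e))%:E)%E.
  rewrite sumEFin; congr EFin.
  rewrite -(pair_big xpredT xpredT
    (fun i j => M i j * (center_dist q i j + 2 * e)))/=.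
  under [RHS]eq_bigr do (under eq_bigr do rewrite mulrDr;
    rewrite big_split/= -mulr_suml MG1).
  by rewrite big_split/= -mulr_suml sum_mass mul1r.
apply: lee_sum => -[i j] _ /=.
apply: (@le_trans _ _
    (\int[p]_(z in F (i, j)) (center_dist q i j + 2 * e)%:E)%E).
  apply: ge0_le_integral => // -[x y] [[/= xi yj] [/= Tx Ty]].
  rewrite /dist /center_dist lee_fin -xi -yj.
  have h1 := rounding_close Tx; have h2 := rounding_close Ty.
  have h3 := euclidean_dist_triangle (rounding q x) x y.
  have h4 := euclidean_dist_triangle (rounding q y) (rounding q x) y.
  rewrite (euclidean_distC (rounding q y)) in h4.
  by rewrite /rounding in h1 h2 h3 h4; lra.
rewrite integral_cst// muleC EFinM; apply: lee_wpmul2r.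
  by rewrite lee_fin addr_ge0 ?mulr_ge0// euclidean_dist_ge0.
have mNN : measurable (N i `*` N j) by exact: measurableX.
rewrite -pM; apply: le_measure; [exact: mem_set (mF _)|exact: mem_set mNN|].
exact: subIsetl.
Qed.

(** Inside the product of the cells [i] and [j] the plan's mass is spread
    proportionally to the product of [G1] and [G2], that is, with the constant
    density [M i j / (mass q G1 i * mass q G2 j)].  The marginals are right because those of the plan are, and
    cells of mass zero receive nothing from the plan. *)
Lemma plan_to_coupling (M : q_index q -> q_index q -> R) :
  transport_plan (mass q G1) (mass q G2) M ->
  (wasserstein1 G1 G2 <= (plan_cost (center_dist q) M + 2 * e)%:E)%E.
Proof.
move=> planM; have [M0 MG1 MG2] := planM.
pose w i j := M i j / (mass q G1 i * mass q G2 j).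
have w0 i j : 0 <= w i j by rewrite divr_ge0// mulr_ge0// mass_ge0.
have Mz1 i j : mass q G1 i = 0 -> M i j = 0.
  move=> gi; have /eqP := MG1 i; rewrite gi psumr_eq0// => /allP.
  by move=> /(_ j (mem_index_enum j))/= /eqP.
have Mz2 i j : mass q G2 j = 0 -> M i j = 0.
  move=> gi; have /eqP := MG2 j; rewrite gi psumr_eq0// => /allP.
  by move=> /(_ i (mem_index_enum i))/= /eqP.
(* A zero cell mass makes both sides vanish. *)
have wg1 i j : w i j * mass q G1 i = M i j / mass q G2 j.
  have [g0|gn0] := eqVneq (mass q G1 i) 0.
    by rewrite g0 mulr0 Mz1// mul0r.
  by rewrite /w invfM mulrA mulrAC mulfVK.
have wg2 i j : w i j * mass q G2 j = M i j / mass q G1 i.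
  have [g0|gn0] := eqVneq (mass q G2 j) 0.
    by rewrite g0 mulr0 Mz2// mul0r.
  by rewrite /w invfM mulrA mulfVK.
pose K (z : 'rV[R]_d * 'rV[R]_d) := (cell_of q z.1, cell_of q z.2).
pose psi z : \bar R := (w (K z).1 (K z).2)%:E.
have mpsi : measurable_fun setT psi.
  apply: (@measurable_finite_factor _ _ _ _ setT _ K
    (fun ij => (w ij.1 ij.2)%:E : \bar R)) => -[i j].
  rewrite setTI (_ : K @^-1` _ = N i `*` N j); first exact: measurableX.
  by apply/seteqP; split => [[x y] /= [<- <-]|[x y] [/= <- <-]].
have psi0 z : (0 <= psi z)%E by rewrite lee_fin.
have cell A B i j : measurable A -> measurable B ->
    (\int[(G1 \x G2)%E]_(z in (A `&` N i) `*` (B `&` N j)) psi z =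
     (w i j * (fine (G1 (A `&` N i)) * fine (G2 (B `&` N j))))%:E)%E.
  move=> mA mB; have mAN : measurable (A `&` N i) by exact: measurableI.
  have mBN : measurable (B `&` N j) by exact: measurableI.
  rewrite (eq_integral (cst (w i j)%:E)).
    rewrite integral_cst; last exact: measurableX.
    rewrite !EFinM !fineK; [|exact: fin_num_measure|exact: fin_num_measure].
    by congr (_ * _)%E; exact: product_measure1E.
  by move=> [x y] /set_mem [[_ /= xi] [_ /= yj]]; rewrite /psi/= xi yj.
have box A B : measurable A -> measurable B ->
    (\int[(G1 \x G2)%E]_(z in A `*` B) psi z =
     (\sum_i \sum_j
       w i j * (fine (G1 (A `&` N i)) * fine (G2 (B `&` N j))))%:E)%E.
  move=> mA mB.
  pose F (ij : q_index q * q_index q) := (A `&` N ij.1) `*` (B `&` N ij.2).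
  have mF ij : measurable (F ij) by apply: measurableX; exact: measurableI.
  have tF : trivIset setT F.
    by move=> [i j] [i' j'] _ _ [[x y]
      [[[_ /= <-] [_ /= <-]] [[_ /= <-] [_ /= <-]]]].
  have -> : A `*` B = \bigcup_ij F ij.
    apply/seteqP; split => [[x y] [/= Ax By]|[x y] [ij _ [[/= ? _] [? _]]]//].
    by exists (cell_of q x, cell_of q y).
  rewrite ge0_integral_partition//; last exact: measurable_funTS.
  rewrite pair_big/= -sumEFin; apply: eq_bigr => -[i j] _.
  exact: cell.
have fineT G i : fine (prob_on_measure G (setT `&` N i)) = mass q G i.
  by rewrite setTI.
have le_mass (G : prob_on Theta) A i : measurable A ->
    mass q G i = 0 -> fine (G (A `&` N i)) = 0.
  move=> mA gi; suff -> : G (A `&` N i) = 0%E by [].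
  apply: (subset_measure0 (B := N i)) => //; first exact: measurableI.
  by apply: (etrans (esym (massE G i))); rewrite gi.
have total (G : prob_on Theta) A : measurable A ->
    (\sum_i fine (G (A `&` N i)))%:E = G A.
  move=> mA; rewrite -sumEFin.
  rewrite (eq_bigr (fun i => G (A `&` N i))); last first.
    by move=> i _; rewrite fineK// fin_num_measure//; exact: measurableI.
  rewrite -measure_partition.
  - congr (G _); apply/seteqP; split => [x [i _ []]//|x Ax].
    by exists (cell_of q x).
  - by move=> i; exact: measurableI.
  - by apply: trivIset_setIl; exact: trivIset_cell_of.
have marg1 A : measurable A ->
    (\int[(G1 \x G2)%E]_(z in A `*` setT) psi z = G1 A)%E.
  move=> mA; rewrite box// -(total G1)//; congr EFin; apply: eq_bigr => i _.
  under eq_bigr do rewrite fineT mulrCA mulrC wg2 mulrC.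
  rewrite -mulr_sumr -mulr_suml MG1.
  have [g0|gn0] := eqVneq (mass q G1 i) 0; last by rewrite divff// mulr1.
  by rewrite le_mass// mul0r.
have marg2 B : measurable B ->
    (\int[(G1 \x G2)%E]_(z in setT `*` B) psi z = G2 B)%E.
  move=> mB; rewrite box// exchange_big/= -(total G2)//; congr EFin.
  apply: eq_bigr => j _.
  under eq_bigr do rewrite fineT mulrA wg1.
  rewrite -!mulr_suml MG2.
  have [g0|gn0] := eqVneq (mass q G2 j) 0; last by rewrite divff// mul1r.
  by rewrite le_mass// mulr0.
have [p pE] : exists p : probability ('rV[R]_d * 'rV[R]_d)%type R,
    forall A, p A = (\int[(G1 \x G2)%E]_(z in A) psi z)%E.
  apply: exists_density_prob => //.
  by rewrite -setXTT marg1// probability_setT.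
have cpl : is_coupling G1 G2 p.
  by move=> A mA; rewrite !pE; split; [exact: marg1|exact: marg2].
apply: le_trans (coupling_cost_le cpl planM _).
  by apply: ereal_inf_lbound; exists p.
move=> i j; rewrite pE; have := cell setT setT i j measurableT measurableT.
rewrite !setTI => ->; congr EFin.
have [g0|gn0] := eqVneq (mass q G1 i) 0.
  by rewrite -/(mass q G1 i) g0 mul0r mulr0 Mz1.
rewrite -/(mass q G1 i) -/(mass q G2 j) mulrA wg1.
have [g0|g2n0] := eqVneq (mass q G2 j) 0; last by rewrite mulfVK.
by rewrite g0 mulr0 Mz2.
Qed.

End couplings.

(** * The Wasserstein distance up to quantization *)

Section wasserstein.
Context (R : realType) (d : nat) (Theta : parameter_space R d).
Variables (q : quantizer Theta) (e : R).
Hypothesis rounding_close : forall theta, parameter_set Theta theta ->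
  euclidean_dist theta (rounding q theta) <= e.
Implicit Types G H : prob_on Theta.

Lemma wasserstein1_ge0 G1 G2 : (0 <= wasserstein1 G1 G2)%E.
Proof.
apply: le_ereal_inf_tmp => _ [p _ <-]; apply: integral_ge0 => z _.
by rewrite lee_fin euclidean_dist_ge0.
Qed.

(** The product of the cell masses is a plan, and plans have finite cost. *)
Lemma wasserstein1_fin_num G1 G2 : wasserstein1 G1 G2 \is a fin_num.
Proof.
rewrite ge0_fin_numE ?wasserstein1_ge0//.
pose M i j := mass q G1 i * mass q G2 j.
have planM : transport_plan (mass q G1) (mass q G2) M.
  split=> [i j|i|j]; first by rewrite mulr_ge0// mass_ge0.
    by rewrite -mulr_sumr sum_mass mulr1.
  by rewrite -mulr_suml sum_mass mul1r.
apply: le_lt_trans (plan_to_coupling rounding_close planM) _.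
exact: ltry.
Qed.

(** A convenient common upper bound on the distances between centers. *)
Definition center_dist_sum : R := \sum_i \sum_j center_dist q i j.

Lemma center_dist_bounds i j : 0 <= center_dist q i j <= center_dist_sum.
Proof.
have c0 i' j' : 0 <= center_dist q i' j' by exact: euclidean_dist_ge0.
rewrite c0/= /center_dist_sum (bigD1 i)//= (bigD1 j)//= -addrA lerDl.
by rewrite addr_ge0// sumr_ge0// => i' _; rewrite ?sumr_ge0.
Qed.

(** An approximate triangle inequality with two middle measures [H1] and [H2] that
    the quantizer hardly distinguishes. *)
Lemma wasserstein1_le_couplings G1 G2 H1 H2 k
    (p1 p2 : probability ('rV[R]_d * 'rV[R]_d)%type R) :
  (forall i, `|mass q H1 i - mass q H2 i| <= k) ->
  is_coupling H1 (quantized q G1) p1 -> is_coupling H2 (quantized q G2) p2 ->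
  (wasserstein1 G1 G2 <=
   \int[p1]_z (euclidean_dist z.1 z.2)%:E +
   \int[p2]_z (euclidean_dist z.1 z.2)%:E +
   (4 * e + center_dist_sum * (#|q_index q|%:R * k))%:E)%E.
Proof.
move=> H12 cpl1 cpl2.
have [M1 plan1 cost1] := coupling_to_plan rounding_close cpl1.
have [M2 plan2 cost2] := coupling_to_plan rounding_close cpl2.
have [||M planM costM] := @glue_plans _ _ _ _ _ _ _ _ (center_dist q) center_dist_sum k
  plan1 plan2 (sum_mass _ _) (sum_mass _ _) H12.
- exact: center_dist_bounds.
- move=> l i j; rewrite /center_dist (euclidean_distC (center l) (center i)).
  exact: euclidean_dist_triangle.
apply: (le_trans (plan_to_coupling rounding_close planM)).
apply: (@le_trans _ _ ((plan_cost (center_dist q) M1)%:E +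
  (plan_cost (center_dist q) M2)%:E +
  (center_dist_sum * (#|q_index q|%:R * k) + 2 * e)%:E)%E).
  by rewrite -!EFinD lee_fin; lra.
apply: (le_trans (leeD (leeD cost1 cost2) (lexx _))).
rewrite (addeACA _ e%:E) -[leLHS]addeA; apply: leeD => //.
by rewrite -!EFinD lee_fin; lra.
Qed.

End wasserstein.

(** * Measurable minorants of the loss *)

(** Nonnegativity excludes the undefined sum of opposite infinities. *)
Lemma le_add_ereal_inf (R : realType) (A B : set (\bar R)) (w : \bar R) :
  (forall a, A a -> 0 <= a)%E -> (forall b, B b -> 0 <= b)%E ->
  w \is a fin_num ->
  (forall a b, A a -> B b -> w <= a + b)%E ->
  (w <= ereal_inf A + ereal_inf B)%E.
Proof.
move=> A0 B0 wfin wAB.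
have iB0 : (0 <= ereal_inf B)%E by exact: le_ereal_inf_tmp.
have [Afin|] := boolP (ereal_inf A \is a fin_num); last first.
  rewrite ge0_fin_numE; last exact: le_ereal_inf_tmp.
  rewrite -leNgt leye_eq => /eqP ->; rewrite addye ?leey//.
  by rewrite gt_eqF// (lt_le_trans _ iB0).
rewrite -leeBlDl//; apply: le_ereal_inf_tmp => b Bb.
have [bfin|] := boolP (b \is a fin_num); last first.
  by rewrite ge0_fin_numE ?B0// -leNgt leye_eq => /eqP ->; rewrite leey.
rewrite leeBlDl// -leeBlDr//; apply: le_ereal_inf_tmp => a Aa.
by rewrite leeBlDr//; exact: wAB.
Qed.

(** For an integer [K > 1 / k], the level of a point records which of the multiples
    of [1 / K] each [m i] reaches; these finitely many bits determine [m i] up to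
    [1 / K]. *)
Lemma finite_level_map (R : realType) dT (T : measurableType dT) (D : set T)
    (I : finType) (m : I -> T -> R) (k : R) :
  0 < k -> measurable D -> (forall i, measurable_fun D (m i)) ->
  (forall i x, 0 <= m i x <= 1) ->
  exists (J : finType) (lev : T -> J),
    (forall j, measurable (D `&` lev @^-1` [set j])) /\
    (forall x y i, lev x = lev y -> `|m i x - m i y| <= k).
Proof.
move=> k0 mD mm m01.
pose K := (Num.truncn k^-1).+1.
have Kk : K%:R^-1 <= k.
  by rewrite invf_ple ?posrE// ltW// truncnS_gt.
pose lev (x : T) : {ffun I * 'I_K.+1 -> bool} :=
  [ffun il : I * 'I_K.+1 => (il.2 : nat)%:R / K%:R <= m il.1 x].
exists {ffun I * 'I_K.+1 -> bool}, lev; split.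
- move=> j; rewrite (_ : _ `&` _ = D `&` \bigcap_(il in [set: I * 'I_K.+1])
      (D `&` (fun x => (il.2 : nat)%:R / K%:R <= m il.1 x) @^-1` [set j il])).
    apply: measurableI => //; apply: fin_bigcap_measurable.
      exact: finite_finset.
    move=> il _; exact: (measurable_fun_ler (measurable_cst _) (mm il.1)).
  apply/seteqP; split => [x [Dx <-]|x [Dx jx]].
    by split => // il _; split => //=; rewrite /lev ffunE.
  by split => //=; apply/ffunP => il; rewrite /lev ffunE; have [] := jx il Logic.I.
- have one x y i : lev x = lev y -> m i x <= m i y + k.
    move=> xy; pose l := Num.truncn (K%:R * m i x).
    have Km0 : 0 <= K%:R * m i x by rewrite mulr_ge0//; have /andP[] := m01 i x.
    have lK : (l < K.+1)%N.
      rewrite ltnS -(ler_nat R); apply: (@le_trans _ _ (K%:R * m i x)).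
        by rewrite /l truncn_le.
      by rewrite ler_piMr//; have /andP[] := m01 i x.
    have /ffunP/(_ (i, Ordinal lK)) := xy; rewrite !ffunE/= => lxy.
    have lx : l%:R / K%:R <= m i x.
      by rewrite ler_pdivrMr ?ltr0n// mulrC truncn_le.
    have ly : l%:R / K%:R <= m i y by rewrite -lxy.
    apply: (@le_trans _ _ (l.+1%:R / K%:R)).
      by rewrite ler_pdivlMr ?ltr0n// mulrC ltW// truncnS_gt.
    by rewrite -natr1 mulrDl mul1r lerD.
  move=> x y i xy; have h1 := one x y i xy; have h2 := one y x i (esym xy).
  by rewrite ler_norml; apply/andP; split; lra.
Qed.

(** The sigma-algebra on probabilities is generated by the sets where the mass of
    some measurable set is below some [r] in [[0, 1]]; for the other values of [r]
    the condition is always or never satisfied. *)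
Lemma measurable_pprobability_eval (R : realType) d1 d2 (T : measurableType d1)
    (Y : measurableType d2) (D : set T) (P : T -> pprobability Y R) (U : set Y) :
  measurable_fun D P -> measurable U ->
  measurable_fun D (fun x => (P x : probability Y R) U).
Proof.
move=> mP mU mD.
apply: (measurability _ (ErealGenInftyO.measurableE R)) => // _ /= -[_ [r ->] <-].
rewrite preimage_itvNyo -/(P @^-1` mset U r).
have [r0|r0] := leP 0 r; last by rewrite lt0_mset// preimage_set0 setI0.
have [r1|r1] := leP r 1; last by rewrite gt1_mset// preimage_setT setIT.
apply: mP => //; apply: sub_sigma_algebra; exists r => /=.
  by rewrite in_itv/= r0.
by exists U.
Qed.

Lemma measurable_sample_power (R : realType) (d : nat) (X : sample_space R d)
    (n : nat) : measurable (sample_power X n).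
Proof.
rewrite (_ : sample_power X n = \bigcap_(i in [set: 'I_n])
    ((fun x : n.-tuple 'rV[R]_d => tnth x i) @^-1` (X : set _))).
  apply: fin_bigcap_measurable; first exact: finite_finset.
  move=> i _; rewrite -[X in measurable X]setTI.
  by apply: measurable_tnth => //; exact: measurable_sample_set.
by apply/seteqP; split=> x /= Xx i; [move=> _|]; exact: Xx.
Qed.

Section estimator_loss.
Context (R : realType) (d1 d2 : nat) (X : sample_space R d1)
  (Theta : parameter_space R d2) (n : nat).
Variables (q : quantizer Theta) (e : R).
Hypothesis rounding_close : forall theta, parameter_set Theta theta ->
  euclidean_dist theta (rounding q theta) <= e.
Variables (Ghat : n.-tuple 'rV[R]_d1 -> prob_on Theta).
Hypothesis estGhat : estimators X Theta n Ghat.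
Local Notation XN := (sample_power X n).
Local Open Scope ereal_scope.

(** The minorants at [x] are the infima of the coupling costs over all the samples
    in the class of [x] for [finite_level_map], applied to the cell masses of the
    estimate.  They take finitely many values, so they are measurable, and
    [wasserstein1_le_couplings] applies to any two samples of a class. *)
Lemma measurable_loss_minorants (G1 G2 : prob_on Theta) (del : R) : (0 < del)%R ->
  exists L1 L2 : n.-tuple 'rV[R]_d1 -> \bar R,
  [/\ measurable_fun setT L1, measurable_fun setT L2,
      forall x, 0 <= L1 x /\ 0 <= L2 x,
      forall x, XN x -> L1 x <= wasserstein1 (Ghat x) (quantized q G1) /\
                        L2 x <= wasserstein1 (Ghat x) (quantized q G2) &
      forall x, XN x ->
        wasserstein1 G1 G2 <= L1 x + L2 x + (4 * e + del)%:E].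
Proof.
move=> del0; have [mGhat _] := estGhat.
have mXN : measurable XN by exact: measurable_sample_power.
have D0 : (0 <= center_dist_sum q)%R.
  by rewrite /center_dist_sum; do 2 apply: sumr_ge0 => ? _; exact: euclidean_dist_ge0.
pose c := (center_dist_sum q * #|q_index q|%:R)%R.
have c0 : (0 <= c)%R by rewrite mulr_ge0.
pose k := (del / (c + 1))%R.
have k0 : (0 < k)%R by rewrite divr_gt0// ltr_wpDl.
have ck : (c * k <= del)%R.
  by rewrite /k mulrCA ger_pMr// ler_pdivrMr ?mul1r ?ltr_wpDl// lerDl.
have [i|i x|J [lev [mlev levk]]] := @finite_level_map R _ _ XN (q_index q)
    (fun i x => mass q (Ghat x) i) k k0 mXN.
- apply: (measurableT_comp (fine_measurable measurableT)).
  apply: (measurable_pprobability_eval mGhat).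
  exact: measurable_cell_of.
- rewrite mass_ge0/= -lee_fin massE; exact: probability_le1 (measurable_cell_of i).
pose costs (G : prob_on Theta) (j : J) : set (\bar R) :=
  [set (\int[p]_z (euclidean_dist z.1 z.2)%:E) | p in
    [set p | exists y, [/\ XN y, lev y = j &
      is_coupling (Ghat y) (quantized q G) p]]].
pose L (G : prob_on Theta) (j : J) := ereal_inf (costs G j).
have L0 G j : 0 <= L G j.
  apply: le_ereal_inf_tmp => _ [p _ <-]; apply: integral_ge0 => z _.
  by rewrite lee_fin euclidean_dist_ge0.
have mL G : measurable_fun XN (L G \o lev).
  exact: (@measurable_finite_factor _ _ _ _ XN _ lev (L G) mlev).
exists ((L G1 \o lev) \_ XN), ((L G2 \o lev) \_ XN); split.
- by apply/(measurable_restrictT _ mXN); exact: mL.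
- by apply/(measurable_restrictT _ mXN); exact: mL.
- by move=> x; split; apply: erestrict_ge0 => y _; exact: L0.
- move=> x Xx; rewrite !patchE mem_set//; split;
    (apply: ereal_inf_le_tmp => _ [p cp <-]; exists p => //; by exists x).
- move=> x Xx; rewrite !patchE mem_set//= -leeBlDr//.
  set w := wasserstein1 G1 G2.
  have cost0 G j a : costs G j a -> 0 <= a.
    move=> [p _ <-]; apply: integral_ge0 => z _.
    by rewrite lee_fin euclidean_dist_ge0.
  apply: le_add_ereal_inf; [exact: cost0|exact: cost0| |].
    by rewrite fin_numB (wasserstein1_fin_num rounding_close).
  move=> _ _ [p1 [y1 [Xy1 ly1 cp1]] <-] [p2 [y2 [Xy2 ly2 cp2]] <-].
  rewrite leeBlDr//.
  apply: (le_trans (wasserstein1_le_couplings rounding_close _ cp1 cp2)).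
    by move=> i; apply: levk; rewrite ly1 ly2.
  rewrite leeD2l// lee_fin lerD2l; apply: le_trans ck.
  by rewrite /c mulrA.
Qed.

End estimator_loss.

(** * Domination between product measures *)

Section domination.
Local Open Scope ereal_scope.
Context (R : realType) dT (T : measurableType dT).

Lemma le_integral_dominated (P Q : {measure set T -> \bar R}) (a : R)
    (S : set T) (h : T -> \bar R) :
  (0 <= a)%R -> (forall A, measurable A -> a%:E * Q A <= P A) ->
  measurable S -> measurable_fun setT h -> (forall x, 0 <= h x) ->
  a%:E * \int[Q]_(x in S) h x <= \int[P]_(x in S) h x.
Proof.
move=> a0 QP mS mh h0.
rewrite -(@ge0_integral_mscale _ _ _ Q S mS (NngNum a0)) //; last first.
  exact: measurable_funTS.
exact: ge0_le_measure_integral.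
Qed.

(** Fubini and induction: each factor costs one power of [a]. *)
Lemma le_prob_power (P Q : probability T R) (a : R) :
  (0 <= a)%R -> (forall A, measurable A -> a%:E * Q A <= P A) ->
  forall n A, measurable A -> (a ^+ n)%:E * prob_power Q n A <= prob_power P n A.
Proof.
move=> a0 QP; elim=> [|n IHn] A mA; first by rewrite expr0 mul1e.
pose B := @tuple_cons _ T n @^-1` A.
have mcons : measurable_fun setT (@tuple_cons _ T n) by exact: measurable_cons.
have mB : measurable B by rewrite -[B]setTI; exact: mcons.
have powE (P0 : probability T R) :
    prob_power P0 n.+1 A = \int[P0]_x prob_power P0 n (xsection B x) by [].
rewrite !powE.
have mQ : measurable_fun setT (fun x => prob_power Q n (xsection B x)).
  exact: measurable_fun_xsection.
have mP : measurable_fun setT (fun x => prob_power P n (xsection B x)).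
  exact: measurable_fun_xsection.
have an0 : (0 <= a ^+ n)%R by exact: exprn_ge0.
rewrite exprSr EFinM -muleA.
apply: (@le_trans _ _ ((a ^+ n)%:E * \int[P]_x prob_power Q n (xsection B x))).
  apply: lee_wpmul2l => //; exact: le_integral_dominated.
rewrite -ge0_integralZl//.
apply: ge0_le_integral => //.
- by move=> x _; rewrite mule_ge0.
- exact: measurable_funeM.
- by move=> x _; apply: IHn; exact: measurable_xsection.
Qed.

End domination.

(** * Convergence of the mixture densities *)

Section mixture_overlap.
Context (R : realType) (d1 d2 : nat) (X : sample_space R d1)
  (Theta : parameter_space R d2) (f : density_kernel X Theta).
Variable q_ : nat -> quantizer Theta.
Hypothesis q_fine : forall m, mesh_lt (q_ m) m.+1%:R^-1.
Implicit Types G : prob_on Theta.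
Local Open Scope ereal_scope.

Let mTheta : measurable (Theta : set 'rV[R]_d2).
Proof. exact: measurable_parameter_set. Qed.

Let mX : measurable (X : set 'rV[R]_d1).
Proof. exact: measurable_sample_set. Qed.

(** The limit is taken inside [Theta] because continuity of the kernel is only
    assumed there. *)
Lemma cvg_rounding theta : parameter_set Theta theta ->
  rounding (q_ m) theta @[m --> \oo] --> within Theta (nbhs theta).
Proof.
move=> Tt U /nbhs_ballP[e /= e0 eU].
have small : \forall m \near \oo, (m.+1%:R^-1 < e)%R.
  exact: (near_infty_natSinv_lt (PosNum e0)).
apply: filterS small => m me; have : ball theta e (rounding (q_ m) theta).
  by apply/ball_sym/(le_ball (ltW me))/q_fine.
by move/eU; apply; exact: center_in.
Qed.

Lemma measurable_kernel_section x : sample_set X x ->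
  measurable_fun Theta (fun theta => (f x theta)%:E).
Proof.
move=> Xx; apply/measurable_EFinP.
apply: (measurable_comp (measurableX mX mTheta) _ (kernel_measurable f)
  (measurable_funTS (pair1_measurable x))).
by move=> _ [t Tt <-].
Qed.

Lemma measurable_kernel_rounding (q : quantizer Theta) x :
  measurable_fun setT (fun theta => (f x (rounding q theta))%:E).
Proof.
apply: (@measurable_finite_factor _ _ _ _ _ _ (cell_of q)
  (fun i => (f x (center i))%:E : \bar R)) => i.
by rewrite setTI; exact: measurable_cell_of.
Qed.

(** Change of variables; the rounding maps the whole space into [Theta]. *)
Lemma mixture_density_quantized G (q : quantizer Theta) x : sample_set X x ->
  mixture_density f (quantized q G) x =
  \int[G]_(theta in Theta) (f x (rounding q theta))%:E.
Proof.
move=> Xx; rewrite /mixture_density.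
transitivity (\int[pushforward G (rounding q)]_(theta in Theta) (f x theta)%:E).
  exact: eq_measure_integral.
rewrite (ge0_integral_pushforward (measurable_rounding q) _ mTheta
  (measurable_kernel_section Xx)); last first.
  by move=> t /set_mem Tt; rewrite lee_fin kernel_ge0.
have -> : rounding q @^-1` Theta = setT.
  by apply/seteqP; split => // t _; exact: center_in.
rewrite (ge0_negligible_integral (measurableC mTheta))//.
- by rewrite setTD setCK.
- exact: measurable_kernel_rounding.
- by move=> t _; rewrite lee_fin kernel_ge0//; exact: center_in.
- exact: prob_on_setC.
Qed.

Lemma kernel_bounded x : {within Theta, continuous (f x)} ->
  exists M, forall theta, parameter_set Theta theta -> (f x theta <= M)%R.
Proof.
move=> cf; have cT : compact (Theta : set 'rV[R]_d2).
  exact: parameter_set_compact.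
have /compact_bounded [M [_ bM]] := continuous_compact cf cT.
exists (M + 1)%R => t Tt; apply: (le_trans (ler_norm _)).
by apply: (bM (M + 1)%R); [rewrite ltrDl|exists t].
Qed.

(** Dominated convergence: a continuous function on a compact set is bounded. *)
Lemma cvg_mixture_density G x : sample_set X x ->
  {within Theta, continuous (f x)} ->
  mixture_density f (quantized (q_ m) G) x @[m --> \oo] -->
  mixture_density f G x.
Proof.
move=> Xx cf; have [M fM] := kernel_bounded cf.
under eq_cvg do rewrite mixture_density_quantized//.
apply: (@dominated_cvg _ _ _ G Theta mTheta
  (fun m theta => (f x (rounding (q_ m) theta))%:E) _ (cst M%:E)).
- by move=> m; apply: measurable_funTS; exact: measurable_kernel_rounding.
- move=> t Tt; apply: cvg_EFin; first exact: nearW.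
  have /subspace_continuousP/(_ t Tt) cft := cf.
  exact: (cvg_comp _ _ (cvg_rounding Tt) cft).
- by [].
- by apply: finite_measure_integrable_cst; exact: mTheta.
- move=> m t Tt; have Trt : parameter_set Theta (rounding (q_ m) t).
    exact: center_in.
  by rewrite gee0_abs ?lee_fin ?kernel_ge0// fM.
Qed.

End mixture_overlap.

(** * A common part of the two mixtures *)

Lemma cvg_mine (R : realType) (u v : nat -> \bar R) (a b : \bar R) :
  u @ \oo --> a -> v @ \oo --> b ->
  (fun m => mine (u m) (v m)) @ \oo --> mine a b.
Proof.
move=> ua vb.
exact: (cvg_comp _ _ (cvg_pair ua vb) (@min_continuous _ (\bar R) (a, b))).
Qed.

Section common_part.
Context (R : realType) (d1 d2 : nat) (X : sample_space R d1)
  (Theta : parameter_space R d2) (f : density_kernel X Theta).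
Variable q_ : nat -> quantizer Theta.
Hypothesis q_fine : forall m, mesh_lt (q_ m) m.+1%:R^-1.
Hypothesis f_cont : {ae base_measure X, forall x,
  sample_set X x -> {within Theta, continuous (f x)}}.
Variables (G1 G2 : prob_on Theta).
Hypothesis pG12 : {ae base_measure X, forall x,
  sample_set X x -> mixture_density f G1 x = mixture_density f G2 x}.
Local Open Scope ereal_scope.

Let p : 'rV[R]_d1 -> \bar R := mixture_density f G1.
Let p1 m := mixture_density f (quantized (q_ m) G1).
Let p2 m := mixture_density f (quantized (q_ m) G2).

Let mX : measurable (X : set 'rV[R]_d1).
Proof. exact: measurable_sample_set. Qed.

Lemma mixture_probE (G : prob_on Theta) A :
  mixture_prob f G A = \int[base_measure X]_(x in A `&` X) mixture_density f G x.
Proof. by []. Qed.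

Lemma integral_mixture_density (G : prob_on Theta) :
  \int[base_measure X]_(x in X) mixture_density f G x = 1.
Proof.
rewrite -[X in \int[_]_(x in X) _]setTI -mixture_probE.
exact: probability_setT.
Qed.

(** Taking the minimum also with the limit [p] makes [p] a dominating function, so
    that convergence almost everywhere gives convergence of the integrals. *)
Lemma cvg_integral_min_density :
  \int[base_measure X]_(x in X) mine (mine (p1 m x) (p2 m x)) (p x)
    @[m --> \oo] --> (1 : \bar R).
Proof.
rewrite -(integral_mixture_density G1).
have mdens := measurable_mixture_density f.
have ge0 (G : prob_on Theta) x : sample_set X x -> 0 <= mixture_density f G x.
  exact: mixture_density_ge0.
have [|||||_ _] := @dominated_convergence _ _ _ (base_measure X) X mX
  (fun m x => mine (mine (p1 m x) (p2 m x)) (p x)) p p.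
- move=> m; apply: measurable_mine; last exact: mdens.
  by apply: measurable_mine; exact: mdens.
- exact: mdens.
- apply: filterS2 f_cont pG12 => x cf pp Xx.
  have cx := cf Xx.
  have := @cvg_mixture_density _ _ _ _ _ f q_ q_fine G1 x Xx cx.
  have := @cvg_mixture_density _ _ _ _ _ f q_ q_fine G2 x Xx cx.
  rewrite -pp// -/(p x) => c2 c1.
  have c0 : p x @[_ --> \oo] --> p x by exact: cvg_cst.
  by have := cvg_mine (cvg_mine c1 c2) c0; rewrite !minxx.
- apply/integrableP; split; first exact: mdens.
  rewrite (eq_integral p); first by rewrite integral_mixture_density ltry.
  by move=> x /set_mem Xx; rewrite gee0_abs// ge0.
- apply: aeW => x m Xx; rewrite gee0_abs ?ge_min ?lexx ?orbT//.
  by rewrite !le_min !ge0.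
- by [].
Qed.

(** [Q] is the normalized minimum of the two densities, and the minimum integrates
    to at least [a] for fine quantizers. *)
Lemma exists_common_part (a : R) : (0 < a < 1)%R ->
  \forall m \near \oo, exists Q : probability 'rV[R]_d1 R,
    Q X = 1 /\ forall A, measurable A ->
      a%:E * Q A <= mixture_prob f (quantized (q_ m) G1) A /\
      a%:E * Q A <= mixture_prob f (quantized (q_ m) G2) A.
Proof.
move=> /andP[a0 a1].
have nbhs1 : nbhs (1 : \bar R) [set y | a%:E < y].
  by apply: open_ereal_gt'; rewrite lte_fin.
have near_a : \forall m \near \oo, a%:E <
    \int[base_measure X]_(x in X) mine (mine (p1 m x) (p2 m x)) (p x).
  exact: (cvg_integral_min_density nbhs1).
apply: filterS near_a => m am.
pose h := (fun x => mine (p1 m x) (p2 m x)) \_ X.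
have h0 x : 0 <= h x.
  by apply: erestrict_ge0 => y Xy; rewrite le_min !mixture_density_ge0.
have mmin : measurable_fun X (fun x => mine (p1 m x) (p2 m x)).
  by apply: measurable_mine; exact: measurable_mixture_density.
have mh : measurable_fun setT h by exact/(measurable_restrictT _ mX).
have [nu nuE] := exists_density_measure (base_measure X) mh h0.
have nuX A : nu A = \int[base_measure X]_(x in A `&` X) mine (p1 m x) (p2 m x).
  by rewrite nuE /h integral_mkcondr.
have nuT : nu setT = nu X by rewrite !nuX setTI setIid.
have nu_le A : measurable A ->
    nu A <= mixture_prob f (quantized (q_ m) G1) A /\
    nu A <= mixture_prob f (quantized (q_ m) G2) A.
  move=> mA; rewrite nuX !mixture_probE.
  have mAX : measurable (A `&` X) by exact: measurableI.
  have mAXf (g : _ -> \bar R) : measurable_fun X g -> measurable_fun (A `&` X) g.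
    by apply: measurable_funS => // x [].
  split; apply: ge0_le_integral => //; try (by apply: mAXf => //;
    exact: measurable_mixture_density);
    try (by move=> x [_ Xx]; rewrite le_min !mixture_density_ge0);
    by move=> x _; rewrite ge_min lexx ?orbT.
have nu1 : nu setT <= 1.
  have [le1 _] := nu_le _ measurableT; apply: (le_trans le1).
  exact: probability_le1.
have nufin : nu setT \is a fin_num.
  by rewrite ge0_fin_numE// (le_lt_trans nu1)// ltry.
pose z := fine (nu setT).
have zE : z%:E = nu setT by rewrite fineK.
have az : (a <= z)%R.
  rewrite -lee_fin zE nuT nuX setIid; apply/ltW/(lt_le_trans am).
  apply: ge0_le_integral => //.
  - by move=> x Xx; rewrite !le_min !mixture_density_ge0.
  - by apply: measurable_mine => //; exact: measurable_mixture_density.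
  - by move=> x _; rewrite ge_min lexx.
have z0 : (0 < z)%R by exact: lt_le_trans az.
have QE A : mnormalize nu (dirac point) A = nu A * (z^-1)%:E.
  by rewrite /mnormalize -zE eqe (gt_eqF z0).
exists (mnormalize nu (dirac point)); split.
  by apply: (etrans (QE _)); rewrite -nuT -zE -EFinM divff// gt_eqF.
move=> A mA; have aQ : a%:E * mnormalize nu (dirac point) A <= nu A.
  rewrite QE muleCA -EFinM -[leRHS]mule1; apply: lee_wpmul2l => //.
  by rewrite lee_fin ler_pdivrMr// mul1r.
by have [h1 h2] := nu_le A mA; split; exact: (le_trans aQ).
Qed.

End common_part.

(** * The lower bound *)

Section nonmeasurable.
Import HBNNSimple.

(** The integral of a nonnegative function is the supremum of the integrals of the
    simple functions below it, which is monotone without any measurability.  This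
    is how the loss is compared with its minorants. *)
Lemma ge0_le_integral_nonmeasurable dT (T : measurableType dT) (R : realType)
    (mu : {measure set T -> \bar R}) (D : set T) (g h : T -> \bar R) :
  (forall x, D x -> 0 <= g x)%E -> (forall x, D x -> g x <= h x)%E ->
  (\int[mu]_(x in D) g x <= \int[mu]_(x in D) h x)%E.
Proof.
move=> g0 gh; rewrite !ge0_integralE//; last first.
  by move=> x Dx; apply: le_trans (g0 x Dx) (gh x Dx).
apply: ge_ereal_sup => _ [s /= sg <-]; apply: le_ereal_sup_tmp.
exists (sintegral mu s) => //; exists s => //= x.
by apply: (le_trans (sg x)); exact: lee_restrict.
Qed.

End nonmeasurable.

Lemma bernoulli_inequality (R : realFieldType) (x : R) n :
  0 <= x <= 1 -> 1 - n%:R * x <= (1 - x) ^+ n.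
Proof.
move=> /andP[x0 x1]; elim: n => [|n IHn]; first by rewrite mul0r subr0 expr0.
rewrite exprS.
apply: (@le_trans _ _ ((1 - x) * (1 - n%:R * x))).
  rewrite -natr1; have : 0 <= n%:R * x * x by rewrite !mulr_ge0.
  by nra.
by rewrite ler_wpM2l// subr_ge0.
Qed.

Theorem proposition3 (R : realType) (d1 d2 : nat)
  (X : sample_space R d1) (Theta : parameter_space R d2)
  (f : density_kernel X Theta)
  (f_cont : {ae base_measure X, forall x,
     sample_set X x -> {within Theta, continuous (f x)}})
  (G1 G2 : prob_on Theta)
  (G1_neq_G2 : ~ (forall A : set 'rV[R]_d2, measurable A -> G1 A = G2 A))
  (pG1_eq_pG2 : {ae base_measure X, forall x,
     sample_set X x -> mixture_density f G1 x = mixture_density f G2 x}) :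
  ((3 / 32)%:E * wasserstein1 G1 G2 <=
   ereal_inf [set ereal_inf [set ereal_sup [set wasserstein1_risk f Ghat G
                                           | G in discrete_prob_on Theta]
                            | Ghat in estimators X Theta n]
             | n in [set: nat]])%E.
Proof.
apply: le_ereal_inf_tmp => _ [n _ <-]; apply: le_ereal_inf_tmp => _ [Ghat est <-].
set S := ereal_sup _.
have /choice [q_ q_fine] :
    forall m, exists q : quantizer Theta, mesh_lt q m.+1%:R^-1.
  by move=> m; apply: exists_quantizer; rewrite invr_gt0.
have risk_le m G : (wasserstein1_risk f Ghat (quantized (q_ m) G) <= S)%E.
  apply: ereal_sup_ubound; exists (quantized (q_ m) G) => //.
  exact: quantized_discrete.
have close m e : d2%:R * m.+1%:R^-1 <= e -> forall theta,
    parameter_set Theta theta -> euclidean_dist theta (rounding (q_ m) theta) <= e.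
  move=> me theta Tt; apply: le_trans me; rewrite euclidean_distC.
  exact/euclidean_dist_ball/q_fine.
have wfin : wasserstein1 G1 G2 \is a fin_num.
  exact: (wasserstein1_fin_num (close 0%N _ (lexx _))).
rewrite -(fineK wfin) -EFinM; set w := fine _.
have wE : w%:E = wasserstein1 G1 G2 by rewrite fineK.
have [w0|w0] := leP w 0.
  apply: (@le_trans _ _ 0%E).
    by rewrite lee_fin mulr_ge0_le0.
  apply: le_trans (risk_le 0%N G1); apply: integral_ge0 => x _.
  exact: wasserstein1_ge0.
(* Bernoulli's inequality gives (1 - t) ^ n >= 1 - n t >= 1/2. *)
pose t : R := (2 * n.+1%:R)^-1.
have n1 : 0 < n.+1%:R :> R by rewrite ltr0n.
have t01 : 0 < t <= 2^-1.
  by rewrite invr_gt0 mulr_gt0//= lef_pV2 ?posrE ?mulr_gt0// ler_peMr// ler1n.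
pose a := 1 - t.
have a01 : 0 < a < 1 by rewrite /a; apply/andP; split; lra.
have [a0 _] := andP a01.
have an : 2^-1 <= a ^+ n.
  apply: le_trans (bernoulli_inequality n _); last by apply/andP; split; lra.
  have : n%:R * t <= 2^-1.
    rewrite /t invfM mulrCA ger_pMr// ler_pdivrMr// mul1r ler_nat.
    exact: leqnSn.
  by lra.
(* The approximation error 4 e + del of the minorants is w / 2 for e = w / 16 and
   del = w / 4. *)
have near_mesh : \forall m \near \oo, d2%:R * m.+1%:R^-1 <= w / 16.
  have c0 : 0 < w / 16 / (d2%:R + 1) by rewrite !divr_gt0// ltr_wpDl.
  apply: filterS (near_infty_natSinv_lt (PosNum c0)) => m /= /ltW mc.
  apply: (@le_trans _ _ (d2%:R * (w / 16 / (d2%:R + 1)))).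
    by rewrite ler_wpM2l.
  rewrite mulrCA ger_pMr ?divr_gt0// ler_pdivrMr ?ltr_wpDl// mul1r.
  by rewrite lerDl.
have [m [mesh_m [Q [QX QP]]]] := filter_ex (filterI near_mesh
  (exists_common_part q_fine f_cont pG1_eq_pG2 a01)).
have del0 : 0 < w / 4 by rewrite divr_gt0.
have [L1 [L2 [mL1 mL2 L0 LW Lw]]] :=
  measurable_loss_minorants (close m _ mesh_m) est G1 G2 del0.
pose XN := sample_power X n.
have mXN : measurable XN by exact: measurable_sample_power.
have QN1 : prob_power Q n XN = 1%E.
  have box := prob_power_box Q (fun _ : 'I_n => measurable_sample_set X).
  by apply: (etrans box); rewrite big1// => i _; exact: QX.
have risk_ge G (L : n.-tuple 'rV[R]_d1 -> \bar R) : measurable_fun setT L ->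
    (forall x, 0 <= L x)%E ->
    (forall x, XN x -> L x <= wasserstein1 (Ghat x) (quantized (q_ m) G))%E ->
    (forall A, measurable A ->
      a%:E * Q A <= mixture_prob f (quantized (q_ m) G) A)%E ->
    ((a ^+ n)%:E * \int[prob_power Q n]_(x in XN) L x <= S)%E.
  move=> mL Lge0 LeW QPG; apply: le_trans (risk_le m G).
  apply: (@le_trans _ _ (\int[prob_power
      (mixture_prob f (quantized (q_ m) G)) n]_(x in XN) L x)%E); last first.
    exact: ge0_le_integral_nonmeasurable.
  apply: le_integral_dominated => //; first by rewrite exprn_ge0// ltW.
  by apply: le_prob_power => //; exact: ltW.
have r1 : ((a ^+ n)%:E * \int[prob_power Q n]_(x in XN) L1 x <= S)%E.
  apply: (risk_ge G1) => // [x|x Xx|A mA]; first exact: (L0 x).1.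
    exact: (LW x Xx).1.
  exact: (QP A mA).1.
have r2 : ((a ^+ n)%:E * \int[prob_power Q n]_(x in XN) L2 x <= S)%E.
  apply: (risk_ge G2) => // [x|x Xx|A mA]; first exact: (L0 x).2.
    exact: (LW x Xx).2.
  exact: (QP A mA).2.
have half : ((w / 2)%:E <= \int[prob_power Q n]_(x in XN) (L1 x + L2 x))%E.
  apply: (@le_trans _ _ (\int[prob_power Q n]_(x in XN) (w / 2)%:E)%E).
    rewrite integral_cst// [X in (_ * X)%E](_ : _ = 1%E) ?mule1//.
  apply: ge0_le_integral_nonmeasurable => x Xx; first by rewrite lee_fin ltW ?divr_gt0.
  have := Lw x Xx; rewrite -wE -leeBlDr// -EFinB.
  by rewrite (_ : w - _ = w / 2)//; lra.
(* The constants: a ^ n * (w / 2) >= w / 4 bounds the sum of two risks, hence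
   S >= w / 8 > 3 / 32 * w. *)
have SS : ((w / 4)%:E <= S + S)%E.
  apply: le_trans (leeD r1 r2); rewrite -ge0_muleDr; last 2 first.
  - by apply: integral_ge0 => x _; exact: (L0 x).1.
  - by apply: integral_ge0 => x _; exact: (L0 x).2.
  rewrite -ge0_integralD//; last 4 first.
  - by move=> x _; exact: (L0 x).1.
  - exact: measurable_funTS.
  - by move=> x _; exact: (L0 x).2.
  - exact: measurable_funTS.
  apply: (@le_trans _ _ ((a ^+ n)%:E * (w / 2)%:E)%E); last first.
    by apply: lee_wpmul2l => //; rewrite lee_fin exprn_ge0// ltW.
  by rewrite -EFinM lee_fin; nra.
rewrite leNgt; apply/negP => Slt.
have S8 : (S < (w / 8)%:E)%E by apply: (lt_le_trans Slt); rewrite lee_fin; lra.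
have := le_lt_trans SS (lteD S8 S8); rewrite -EFinD lte_fin.
by rewrite (_ : w / 8 + w / 8 = w / 4) ?ltxx//; field.
Qed.
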